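(* Let $q$ be a fixed prime power. There is a constant $C>0$ (depending on $q$) such that for every $n\ge 2$ and every $\mathbf M\in\mathrm{GL}(n,q)$ there exist parallel Gaussian elimination matrices $\mathbf R_1,\dots,\mathbf R_d$ over $\mathbb F_q$ with $d\le C\,n/\log n$ and $\mathbf R_d\cdots\mathbf R_1\mathbf M=\mathbf I$.
   Context: $\mathbf 1_{p,q'}$ denotes the $n\times n$ matrix that is zero except for a $1$ in entry $(p,q')$. Over $\mathbb F_q$, a parallel Gaussian elimination matrix is one of the following: - the identity; - a matrix $\mathbf I+\sum_{k=1}^t c_k\mathbf 1_{j_k,i_k}$ with $c_k\in\mathbb F_q$, where the $2t$ indices $i_1,\dots,i_t,j_1,\dots,j_t\in[n]$ are pairwise distinct (this simultaneously adds $c_k$ times row $i_k$ to row $j_k$ for each $k$); - an invertible diagonal matrix (this scales rows). For $q=2$ the third type is unnecessary. *)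

(* Defs.v *)
From HB Require Import structures.
From mathcomp Require Import all_boot all_order all_algebra all_field.
From Stdlib Require Import Reals.
Set Implicit Arguments. Unset Strict Implicit. Unset Printing Implicit Defensive.
Import GRing.Theory.
Local Open Scope ring_scope.

Definition pgem (F : fieldType) (n : nat) (A : 'M[F]_n) : Prop :=
  A = 1%:M
  \/ (exists (t : nat) (i j : 'I_t -> 'I_n) (c : 'I_t -> F),
        injective i /\ injective j /\ (forall a b, i a != j b) /\
        A = 1%:M + \sum_(k < t) c k *: delta_mx (j k) (i k))
  \/ (exists d : 'rV[F]_n, (forall k, d 0 k != 0) /\ A = diag_mx d).

Definition apply_seq (F : fieldType) (n : nat) (Rs : seq 'M[F]_n) (M : 'M[F]_n)
  : 'M[F]_n := foldl (fun A R => R *m A) M Rs.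

(* Main.v *)
Require Import Defs.
From HB Require Import structures.
From mathcomp Require Import all_boot all_order all_fingroup all_algebra all_field.
From mathcomp Require Import zify ring.
Set Implicit Arguments. Unset Strict Implicit. Unset Printing Implicit Defensive.
Import GRing.Theory.
Local Open Scope ring_scope.

(** Decompose [M^-1] as (permutation)(lower)(diagonal)(upper).  A permutation is
    a product of two involutions, so it has bounded depth.  A unitriangular matrix
    is cut into [q^2] diagonal blocks ([q = #|F|]), which are treated in parallel by recursion;
    what remains are matrices [1 + N] with [N] supported on a rectangle [X * Y] of
    disjoint index sets.

    If every row and column of [N] has at most [s] nonzero entries, then splitting
    the support into matchings gives depth [O(s)].  In general take [k ~ log_q n / 2]
    and [s = q^k ~ sqrt n], and cut [N] into pieces of size [s^2] by [s * k].  By the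
    method of the four Russians each piece factors as [E *m L] through at most
    [2 * s^2] other rows, with [E] and [L] having [O(s)] nonzero entries in each row
    and column; as [1 + E *m L] is the commutator of [1 + E] and [1 + L], it has
    depth [O(s)], whatever those other rows contain.  There are [O(s / k)] pieces,
    whence depth [O(s^2 / k) = O(n / log n)]; summed over the recursion, this grows
    geometrically and stays [O(n / log n)]. *)

(** * Elimination matrices and sparse matrices *)

Section Depth.
Variable F : fieldType.

(** The last clause forbids an index to be both the row and the column of nonzero entries; this
    encodes the pairwise distinctness of all $2t$ indices. *)
Definition matching n (N : 'M[F]_n) : Prop :=
  [/\ forall i j j', N i j != 0 -> N i j' != 0 -> j = j',
      forall i i' j, N i j != 0 -> N i' j != 0 -> i = i' &
      forall i j k, N i j != 0 -> N k i = 0].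

Fixpoint depth (gen : forall n, 'M[F]_n -> Prop) (d n : nat) (A : 'M[F]_n) : Prop :=
  if d is d'.+1 then exists E B, [/\ gen n E, depth gen d' B & A = E *m B]
  else A = 1%:M.

(** Scalings are left out: the block sum of a scaling and a row addition need not be a parallel
    elimination matrix, so [elim_block] would fail. *)
Definition elim n (A : 'M[F]_n) : Prop := matching (A - 1%:M).

Lemma matching0 n : matching (0 : 'M[F]_n).
Proof. by split=> [i j j'|i i' j|i j k]; rewrite mxE ?eqxx. Qed.

Lemma elim1 n : elim (1%:M : 'M[F]_n).
Proof. by rewrite /elim subrr; exact: matching0. Qed.

Lemma matching_elim n (N : 'M[F]_n) : matching N -> elim (1%:M + N).
Proof. by rewrite /elim addrC addKr. Qed.

Lemma matching_tr n (N : 'M[F]_n) : matching N -> matching N^T.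
Proof.
case=> H1 H2 H3; split=> [i j j'|i i' j|i j k]; rewrite ![N^T _ _]mxE.
- exact: H2.
- exact: H1.
- by move=> h; apply/eqP/negPn/negP=> /H3 h'; rewrite h' eqxx in h.
Qed.

Lemma elim_tr n (A : 'M[F]_n) : elim A -> elim A^T.
Proof. by move=> /matching_tr; rewrite linearB /= trmx1. Qed.

Lemma elim_block m n (A : 'M[F]_m) (B : 'M[F]_n) :
  elim A -> elim B -> elim (block_mx A 0 0 B).
Proof.
rewrite /elim => -[A1 A2 A3] [B1 B2 B3].
rewrite -[1%:M in X in matching X]/(1%:M : 'M_(m+n)) (@scalar_mx_block F m n 1).
rewrite opp_block_mx add_block_mx !subr0.
split.
- move=> i j j'; case: (split_ordP i) => i1 ->; case: (split_ordP j) => j1 ->;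
  case: (split_ordP j') => j2 ->; rewrite ?block_mxEul ?block_mxEur ?block_mxEdl ?block_mxEdr
    ?[(0 : 'M__) _ _]mxE ?eqxx //.
  + by move=> h1 h2; rewrite (A1 _ _ _ h1 h2).
  + by move=> h1 h2; rewrite (B1 _ _ _ h1 h2).
- move=> i j j'; case: (split_ordP i) => i1 ->; case: (split_ordP j) => j1 ->;
  case: (split_ordP j') => j2 ->; rewrite ?block_mxEul ?block_mxEur ?block_mxEdl ?block_mxEdr
    ?[(0 : 'M__) _ _]mxE ?eqxx //.
  + by move=> h1 h2; rewrite (A2 _ _ _ h1 h2).
  + by move=> h1 h2; rewrite (B2 _ _ _ h1 h2).
- move=> i j j'; case: (split_ordP i) => i1 ->; case: (split_ordP j) => j1 ->;
  case: (split_ordP j') => j2 ->; rewrite ?block_mxEul ?block_mxEur ?block_mxEdl ?block_mxEdr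
    ?[(0 : 'M__) _ _]mxE ?eqxx //.
  + by move=> h; apply: A3 h.
  + by move=> h; apply: B3 h.
Qed.

Lemma depthM gen d e n (A B : 'M[F]_n) :
  depth gen d A -> depth gen e B -> depth gen (d + e) (A *m B).
Proof.
elim: d A => [|d IH] A /=; first by move=> ->; rewrite mul1mx.
by case=> E [A' [gE dA ->]] dB; exists E, (A' *m B); split=> //; [apply: IH|rewrite mulmxA].
Qed.

Lemma depth1 (gen : forall n, 'M[F]_n -> Prop) n (A : 'M[F]_n) :
  gen n A -> depth gen 1 A.
Proof. by move=> gA; exists A, 1%:M; rewrite mulmx1. Qed.

Lemma depth_sub (gen gen' : forall n, 'M[F]_n -> Prop) d n (A : 'M[F]_n) :
  (forall n (E : 'M_n), gen n E -> gen' n E) -> depth gen d A -> depth gen' d A.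
Proof.
move=> sub; elim: d A => //= d IH A [E [B [gE dB ->]]].
by exists E, B; split; [exact: sub|exact: IH|].
Qed.

Lemma edepth_le (d e n : nat) (A : 'M[F]_n) : (d <= e)%N -> depth elim d A -> depth elim e A.
Proof.
move=> /subnKC <- dA; rewrite -[A]mulmx1; apply: depthM => //.
elim: (e - d)%N => //= c IH; exists 1%:M, 1%:M; rewrite mulmx1; split=> //; exact: elim1.
Qed.

Lemma edepth_tr d n (A : 'M[F]_n) : depth elim d A -> depth elim d A^T.
Proof.
elim: d A => [|d IH] A /=; first by move=> ->; rewrite trmx1.
case=> E [B [eE dB ->]]; rewrite trmx_mul.
by have := depthM (IH _ dB) (depth1 (elim_tr eE)); rewrite addn1.
Qed.

Lemma edepth_block d m n (A : 'M[F]_m) (B : 'M[F]_n) :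
  depth elim d A -> depth elim d B -> depth elim d (block_mx A 0 0 B).
Proof.
elim: d A B => [|d IH] A B /=; first by move=> -> ->; rewrite -scalar_mx_block.
case=> E [A' [eE dA ->]] [E' [B' [eE' dB ->]]].
exists (block_mx E 0 0 E'), (block_mx A' 0 0 B'); split; [exact: elim_block|exact: IH|].
by rewrite mulmx_block !mulmx0 !mul0mx !addr0 !add0r.
Qed.

Lemma elim_pgem n (A : 'M[F]_n) : elim A -> pgem A.
Proof.
rewrite /elim; set N := A - 1%:M => -[H1 H2 H3]; right; left.
pose P := [set p : 'I_n * 'I_n | N p.1 p.2 != 0].
have PP k : N (@enum_val _ (mem P) k).1 (enum_val k).2 != 0 by have := enum_valP k; rewrite inE.
exists #|P|, (fun k => (enum_val k).2), (fun k => (enum_val k).1),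
  (fun k => N (enum_val k).1 (enum_val k).2); split; [|split; [|split]].
- move=> k l e; apply: enum_val_inj; move: (PP k) (PP l) e.
  case: (enum_val k) (enum_val l) => [a b] [a' b'] /= h1 h2 e; rewrite -e in h2 *.
  by rewrite (H2 _ _ _ h1 h2).
- move=> k l e; apply: enum_val_inj; move: (PP k) (PP l) e.
  case: (enum_val k) (enum_val l) => [a b] [a' b'] /= h1 h2 e; rewrite -e in h2 *.
  by rewrite (H1 _ _ _ h1 h2).
- move=> k l; apply/eqP=> e; have := PP k; rewrite e (H3 _ _ _ (PP l)) eqxx //.
- rewrite -[LHS](subrK 1%:M) addrC; congr (_ + _); rewrite -/N.
  rewrite -(@big_enum_val _ _ _ _ (mem P) (fun p => N p.1 p.2 *: delta_mx p.1 p.2)) /=.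
  rewrite [LHS]matrix_sum_delta pair_big /= [LHS](bigID (mem P)) /= addrC big1 ?add0r //.
  by move=> p; rewrite inE negbK => /eqP ->; rewrite scale0r.
Qed.

Definition rdeg n (N : 'M[F]_n) i := #|[set j | N i j != 0]|.
Definition cdeg n (N : 'M[F]_n) j := #|[set i | N i j != 0]|.

(* Each edge left over by a maximal matching meets it, so the sum of the degrees
   of its ends drops. *)
Lemma edepth_sparse (d n : nat) (N : 'M[F]_n) (S : {set 'I_n}) :
  (forall i j, N i j != 0 -> i \in S /\ j \notin S) ->
  (forall i j, N i j != 0 ->
     (rdeg N i + cdeg N j <= d.+1)%N) ->
  depth elim d (1%:M + N).
Proof.
elim: d N => [|d IH] N NS Nd.
  suff -> : N = 0 by rewrite addr0.
  apply/matrixP=> i j; rewrite mxE; apply/eqP/negPn/negP=> nz.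
  (* A nonzero entry counts in both degrees, so their sum is at least 2, against a bound of 1. *)
  have := Nd _ _ nz; rewrite /rdeg /cdeg (cardsD1 j) (cardsD1 i [set i' | _]) !inE nz; lia.
pose P := [set p : 'I_n * 'I_n | N p.1 p.2 != 0].
pose Q (A : {set 'I_n * 'I_n}) := (A \subset P) &&
  [forall p in A, forall p' in A, (p.1 == p'.1) || (p.2 == p'.2) ==> (p == p')].
have [|A /maxsetP[/andP[AP /forall_inP AQ] Amax]] := @ex_maxset _ Q.
  by exists set0; rewrite /Q sub0set; apply/forall_inP=> p; rewrite inE.
pose N1 := \matrix_(i, j) if (i, j) \in A then N i j else 0.
pose N2 := \matrix_(i, j) if (i, j) \in A then 0 else N i j.
have NE : N = N1 + N2.
  by apply/matrixP=> i j; rewrite !mxE; case: ifP; rewrite ?addr0 ?add0r.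
have N1P i j : N1 i j != 0 -> (i, j) \in A /\ N i j != 0.
  by rewrite mxE; case: ifP; rewrite ?eqxx.
have N2P i j : N2 i j != 0 -> (i, j) \notin A /\ N i j != 0.
  by rewrite mxE; case: ifP; rewrite ?eqxx.
have AI i j i' j' : (i, j) \in A -> (i', j') \in A -> (i = i' \/ j = j') -> (i, j) = (i', j').
  move=> h h' e; have /forall_inP /(_ _ h') /implyP := AQ _ h.
  by move=> h2; apply/eqP; apply: h2 => /=; case: e => ->; rewrite eqxx ?orbT.
exists (1%:M + N1), (1%:M + N2); split.
- apply: matching_elim; split.
  + by move=> i j j' /N1P[h _] /N1P[h' _]; case: (AI _ _ _ _ h h' (or_introl erefl)).
  + by move=> i i' j /N1P[h _] /N1P[h' _]; case: (AI _ _ _ _ h h' (or_intror erefl)).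
  + move=> i j k /N1P[_ /NS[iS _]]; apply/eqP/negPn/negP=> /N1P[_ /NS[_]].
    by rewrite iS.
- apply: IH => [i j /N2P[_ /NS] //|i j nz].
  have [nA nzN] := N2P _ _ nz.
  have subr : [set j' | N2 i j' != 0] \subset [set j' | N i j' != 0].
    by apply/subsetP=> j'; rewrite !inE => /N2P[].
  have subc : [set i' | N2 i' j != 0] \subset [set i' | N i' j != 0].
    by apply/subsetP=> i'; rewrite !inE => /N2P[].
  have := Nd _ _ nzN.
  have leR : (rdeg N2 i <= rdeg N i)%N by exact: subset_leq_card.
  have leC : (cdeg N2 j <= cdeg N j)%N by exact: subset_leq_card.
  suff : (rdeg N2 i < rdeg N i)%N \/ (cdeg N2 j < cdeg N j)%N by lia.
  have [/existsP[p /andP[pA pe]]|none] :=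
    boolP [exists p, (p \in A) && ((p.1 == i) || (p.2 == j))].
    have pN : N p.1 p.2 != 0 by have := subsetP AP _ pA; rewrite inE.
    have p2 : N2 p.1 p.2 = 0 by rewrite mxE -surjective_pairing pA.
    case/orP: pe => /eqP pe; rewrite pe in pN p2; [left|right]; apply: proper_card;
      rewrite properE ?subr ?subc /=; apply/subsetPn; [exists p.2|exists p.1];
      by rewrite !inE // p2 eqxx.
  (* An entry sharing no row or column with [A] could be added to it, against maximality. *)
  case/negP: nA; have <- : (i, j) |: A = A; last by rewrite setU11.
  apply: Amax; last exact: subsetUr.
  rewrite /Q subUset sub1set inE nzN AP /=; move/existsPn: none => none.
  apply/forall_inP=> p; rewrite in_setU1 => /predU1P[->|pA]; apply/forall_inP=> p';
    rewrite in_setU1 => /predU1P[->|pA'].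
  + by apply/implyP.
  + by have := none p'; rewrite pA' /= (eq_sym i) (eq_sym j) => /negPf ->.
  + by have := none p; rewrite pA /= => /negPf ->.
  + exact: (forall_inP (AQ _ pA)).
(* Columns of [N1] lie outside [S] and rows of [N2] inside, so [N1 *m N2 = 0]. *)
- rewrite mulmxDl mul1mx mulmxDr mulmx1.
  suff -> : N1 *m N2 = 0 by rewrite addr0 -addrA [N2 + N1]addrC -NE.
  apply/matrixP=> i j; rewrite !mxE big1 // => k _.
  apply/eqP; rewrite mulf_eq0; apply/negPn/negP; rewrite negb_or => /andP[].
  by move=> /N1P[_ /NS[_ /negP h]] /N2P[_ /NS[]].
Qed.

End Depth.

(** * The method of the four Russians *)

Section Cells.
Local Open Scope nat_scope.

Lemma leq_card_inj (T : finType) (A : {set T}) (h : T -> nat) m :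
  {in A &, injective h} -> (forall x, x \in A -> h x < m) -> #|A| <= m.
Proof.
move=> hI hm; rewrite cardE -(size_map h) -[m in _ <= m](size_iota 0); apply: uniq_leq_size.
  by rewrite map_inj_in_uniq ?enum_uniq // => x y; rewrite !mem_enum; apply: hI.
by move=> _ /mapP[x + ->]; rewrite mem_enum mem_iota => /hm.
Qed.

Lemma leq_card_divn (T : finType) (A : {set T}) (h : T -> nat) m c :
  0 < m -> {in A &, injective h} -> (forall x, x \in A -> h x %/ m = c) -> #|A| <= m.
Proof.
move=> m0 hI hc; apply: (@leq_card_inj _ _ (fun x => h x %% m)) => [x y xA yA e|x _].
  by apply: hI => //; rewrite (divn_eq (h x) m) (divn_eq (h y) m) !hc // e.
by rewrite ltn_mod.
Qed.

Lemma set_split (T : finType) (X : {set T}) (m r : nat) : (#|X| <= r.+1 * m)%N ->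
  exists X1 : {set T}, [/\ X1 \subset X, (#|X1| <= m)%N & (#|X :\: X1| <= r * m)%N].
Proof.
move=> cX; pose X1 := [set x in take m (enum X)].
have sX1 : X1 \subset X by apply/subsetP=> x; rewrite inE => /mem_take; rewrite mem_enum.
have cX1 : #|X1| = minn m #|X|.
  by rewrite cardsE (card_uniqP _) ?take_uniq ?enum_uniq // size_take_min -cardE.
exists X1; split=> //; first by rewrite cX1 geq_minl.
by rewrite cardsD (setIidPr sX1) cX1 leq_subLR minnE; move: cX; rewrite mulSn; lia.
Qed.

Variables (T V : finType) (X : {set T}) (v : T -> V) (s : nat).

(** Lexicographic key: first the value [v x], then [x] itself. Sorting by it makes equal values
    adjacent. *)
Definition vkey (x : T) : nat := enum_rank (v x) * #|T| + enum_rank x.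
Definition vpos (x : T) : nat := #|[set y in X | vkey y < vkey x]|.

(* Listing [X] with equal values of [v] adjacent, a new cell is opened at each
   change of value and at each multiple of [s]. *)
Definition cell (x : T) : nat := vpos x %/ s + enum_rank (v x).

Lemma vkey_inj : injective vkey.
Proof.
move=> x y /(congr1 (fun t => t %% #|T|)); rewrite !modnMDl !modn_small //.
by move=> /ord_inj /enum_rank_inj.
Qed.

Lemma leq_vpos x y : vkey x <= vkey y -> vpos x <= vpos y.
Proof.
move=> le; apply: subset_leq_card; apply/subsetP=> z; rewrite !inE => /andP[-> h].
exact: leq_trans h le.
Qed.

Lemma vpos_inj : {in X &, injective vpos}.
Proof.
have lt x y : x \in X -> vkey x < vkey y -> vpos x < vpos y.
  move=> xX lt; apply: proper_card; rewrite properE; apply/andP; split.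
    by apply/subsetP=> z; rewrite !inE => /andP[-> h]; apply: ltn_trans h lt.
  by apply/subsetPn; exists x; rewrite !inE xX ?lt // ltnn.
move=> x y xX yX e; apply: vkey_inj; case: (ltngtP (vkey x) (vkey y)) => //.
  by move/(lt _ _ xX); rewrite e ltnn.
by move/(lt _ _ yX); rewrite e ltnn.
Qed.

Hypotheses (cardX : #|X| <= s ^ 2) (cardV : #|V| <= s).

Lemma cell_lt x : x \in X -> cell x < 2 * s.
Proof.
move=> xX; have : vpos x < s * s.
  apply: leq_trans cardX; apply: proper_card; rewrite properE; apply/andP; split.
    by apply/subsetP=> z; rewrite !inE => /andP[].
  by apply/subsetPn; exists x; rewrite ?inE ?ltnn ?andbF.
have rs : enum_rank (v x) < s := leq_trans (ltn_ord _) cardV.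
have s0 : 0 < s by exact: leq_ltn_trans rs.
by rewrite -ltn_divLR // /cell mul2n -addnn => /ltnW ps; rewrite -addnS leq_add.
Qed.

(** Both summands of [cell] are nondecreasing along the listing, so equal sums force equal
    summands. *)
Lemma cell_eq x y : cell x = cell y ->
  enum_rank (v x) = enum_rank (v y) /\ vpos x %/ s = vpos y %/ s.
Proof.
wlog le : x y / vkey x <= vkey y.
  move=> H; case: (leqP (vkey x) (vkey y)) => [|/ltnW] le e; first exact: H.
  by have [] := H y x le (esym e).
have T0 : 0 < #|T| by apply: leq_ltn_trans (ltn_ord (enum_rank x)).
have := leq_div2r s (leq_vpos le).
have : enum_rank (v x) <= enum_rank (v y).
  by have := leq_div2r #|T| le; rewrite /vkey !divnMDl // !divn_small ?addn0.
rewrite /cell => h1 h2 e; split; [apply: ord_inj|]; lia.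
Qed.

Lemma cell_val x y : cell x = cell y -> v x = v y.
Proof. by case/cell_eq => /enum_rank_inj. Qed.

Lemma card_cell c : #|[set x in X | cell x == c]| <= s.
Proof.
have [->|[x0]] := set_0Vmem [set x in X | cell x == c]; first by rewrite cards0.
rewrite inE => /andP[x0X /eqP x0c].
apply: (@leq_card_divn _ _ vpos _ (vpos x0 %/ s)).
- by have := cell_lt x0X; lia.
- by move=> x y; rewrite !inE => /andP[xX _] /andP[yX _]; apply: vpos_inj.
- by move=> x; rewrite inE => /andP[_ /eqP]; rewrite -x0c => /cell_eq[].
Qed.

End Cells.

Section Block.
Variable F : finFieldType.

(** The relations give [(1 + A)(1 + B) = (1 + AB)(1 + A + B)] and [1 + A + B = (1 + B)(1 + A)]; the
    inverses of [1 + A] and [1 + B] are [1 - A] and [1 - B]. *)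
Lemma commutator_mx n (A B : 'M[F]_n) : A *m A = 0 -> B *m B = 0 -> B *m A = 0 ->
  1%:M + A *m B = (1%:M + A) *m (1%:M + B) *m ((1%:M - A) *m (1%:M - B)).
Proof.
move=> AA BB BA.
have -> : (1%:M + A) *m (1%:M + B) = (1%:M + A *m B) *m ((1%:M + B) *m (1%:M + A)).
  have -> : (1%:M + B) *m (1%:M + A) = 1%:M + A + B.
    by rewrite mulmxDl mul1mx mulmxDr mulmx1 BA addr0.
  rewrite !mulmxDl !mul1mx !mulmxDr !mulmx1 -!(mulmxA A) BA BB !mulmx0 !addr0.
  by rewrite -!addrA; congr (_ + _); rewrite addrCA.
have inv (C : 'M_n) : C *m C = 0 -> (1%:M + C) *m (1%:M - C) = 1%:M.
  by move=> CC; rewrite mulmxDl mul1mx mulmxBr mulmx1 CC subr0 subrK.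
by rewrite -!mulmxA (mulmxA (1%:M + A)) inv // mul1mx inv // mulmx1.
Qed.

Lemma mulmx_support0 n (A B : 'M[F]_n) (X Y : {set 'I_n}) : [disjoint X & Y] ->
  (forall i j, A i j != 0 -> j \in X) -> (forall i j, B i j != 0 -> i \in Y) ->
  A *m B = 0.
Proof.
move=> dXY AX BY; apply/matrixP=> i j; rewrite !mxE big1 // => k _.
apply/eqP; rewrite mulf_eq0; apply/negPn/negP; rewrite negb_or => /andP[/AX kX /BY kY].
by move: (disjointFr dXY kX); rewrite kY.
Qed.

Lemma edepth_sparse_opp (d n : nat) (N : 'M[F]_n) (S : {set 'I_n}) :
  (forall i j, N i j != 0 -> i \in S /\ j \notin S) ->
  (forall i j, N i j != 0 -> (rdeg N i + cdeg N j <= d.+1)%N) ->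
  depth (@elim F) d (1%:M - N).
Proof.
have nz i j : ((- N) i j != 0) = (N i j != 0) by rewrite mxE oppr_eq0.
move=> NS Nd; apply: (@edepth_sparse _ _ _ _ S) => i j; rewrite nz; first exact: NS.
move=> /Nd; rewrite /rdeg /cdeg; congr (_ + _ <= _)%N; apply: eq_card => x; by rewrite !inE nz.
Qed.

(* The method of the four Russians.  The columns are cut into [s] groups of size
   at most [k]; there are at most [s] row patterns per group, hence [N] factors
   as [E *m L], where [L] loads copies of the patterns into the scratch rows [Z]
   (at most [2 * s] rows per group) and [E] distributes them.  Taking a
   commutator allows the scratch rows to have arbitrary contents. *)
Lemma edepth_batch n s k (X Y Z : {set 'I_n}) (N : 'M[F]_n) :
  [disjoint X & Y] -> [disjoint Z & X] -> [disjoint Y & Z] ->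
  (0 < k)%N -> (#|X| <= s ^ 2)%N -> (#|Y| <= s * k)%N -> (2 * s ^ 2 <= #|Z|)%N ->
  (#|F| ^ k <= s)%N -> (forall i j, N i j != 0 -> i \in X /\ j \in Y) ->
  depth (@elim F) (10 * s) (1%:M + N).
Proof.
move=> dXY dZX dYZ k0 cX cY cZ qk NXY.
have s0 : (0 < s)%N.
  by apply: leq_trans qk; rewrite expn_gt0 (leq_trans _ (finNzRing_gt1 F)).
have ks : (k <= s)%N.
  by apply: leq_trans qk; apply: ltnW; apply: ltn_expl; exact: finNzRing_gt1.
pose u y := index y (enum Y); pose w z := index z (enum Z).
have uI : {in Y &, injective u}.
  by move=> y y' yY y'Y /(congr1 (nth y (enum Y))); rewrite !nth_index ?mem_enum.
have wI : {in Z &, injective w}.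
  by move=> y y' yY y'Y /(congr1 (nth y (enum Z))); rewrite !nth_index ?mem_enum.
pose v g i := [ffun j : 'I_k => N i (nth i (enum Y) (g * k + j))].
have cV : (#|{ffun 'I_k -> F}| <= s)%N by rewrite card_ffun card_ord.
pose f g := cell X (v g) s.
(* Element number [g * (2 * s) + c] of [Z] stands for cell [c] with respect to column group [g]; [E]
   adds this scratch row to every row of the cell. *)
pose E := \matrix_(i, z) (if [&& i \in X, z \in Z, w z %/ (2 * s) < s &
   f (w z %/ (2 * s)) i == w z %% (2 * s)]%N then 1 else 0 : F).
(* All rows of a cell agree on the column group, so any representative gives the pattern; an empty
   cell gives a zero row. *)
pose L := \matrix_(z, y) (if [&& z \in Z, y \in Y & u y %/ k == w z %/ (2 * s)]%N then
   if [pick i in X | f (u y %/ k) i == w z %% (2 * s)]%N is Some i then N i y else 0 else 0).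
have EP i z : E i z != 0 -> [/\ i \in X, z \in Z, (w z %/ (2 * s) < s)%N &
    f (w z %/ (2 * s))%N i = (w z %% (2 * s))%N].
  by rewrite mxE; case: ifP => [/and4P[? ? ? /eqP]|]; rewrite ?eqxx.
have LP z y : L z y != 0 -> [/\ z \in Z, y \in Y & (u y %/ k = w z %/ (2 * s))%N].
  by rewrite mxE; case: ifP => [/and3P[? ? /eqP]|]; rewrite ?eqxx.
have NE : N = E *m L.
  apply/matrixP=> i y; rewrite mxE.
  have [/andP[iX yY]|niy] := boolP ((i \in X) && (y \in Y)); last first.
    rewrite big1 => [|z _].
      by apply/eqP/negPn/negP=> /NXY[iX yY]; rewrite iX yY in niy.
    apply/eqP; rewrite mulf_eq0; apply/negPn/negP; rewrite negb_or.
    by move=> /andP[/EP[iX _ _ _] /LP[_ yY _]]; rewrite iX yY in niy.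
  pose g := (u y %/ k)%N; pose c := f g i; pose t := (g * (2 * s) + c)%N.
  have uy : (u y < #|Y|)%N by rewrite cardE index_mem mem_enum.
  have gs : (g < s)%N by rewrite ltn_divLR //; apply: leq_trans cY.
  have cs : (c < 2 * s)%N by apply: cell_lt.
  have tZ : (t < size (enum Z))%N.
    rewrite -cardE; apply: leq_trans cZ; rewrite -mulnn mulnA.
    have : (g.+1 * (2 * s) <= s * (2 * s))%N by rewrite leq_mul2r gs orbT.
    rewrite /t; lia.
  pose z0 := nth i (enum Z) t.
  have z0Z : z0 \in Z by rewrite -mem_enum mem_nth.
  have wz0 : w z0 = t by rewrite /w index_uniq ?enum_uniq.
  have s2 : (0 < 2 * s)%N by rewrite muln_gt0.
  have td : (t %/ (2 * s) = g)%N by rewrite divnMDl // divn_small ?addn0.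
  have tm : (t %% (2 * s) = c)%N by rewrite modnMDl modn_small.
  rewrite (bigD1 z0) //= big1 ?addr0 => [|z zz0].
    rewrite !mxE iX yY z0Z wz0 td tm gs !eqxx mul1r.
    case: pickP => [i' /andP[i'X /eqP e]|/(_ i)]; last by rewrite iX eqxx.
    have := cell_val cX cV e => /ffunP /(_ (Ordinal (ltn_pmod (u y) k0))).
    by rewrite !ffunE /= /g -divn_eq !nth_index ?mem_enum.
  apply/eqP; rewrite mulf_eq0; apply/negPn/negP; rewrite negb_or.
  move=> /andP[/EP[_ zZ _ e1] /LP[_ _ e2]]; case/eqP: zz0; apply: wI => //.
  by rewrite wz0 (divn_eq (w z) (2 * s)) -e1 -e2.
have s2 : (0 < 2 * s)%N by rewrite muln_gt0.
(* The four degree bounds: a row lies in one cell for each of [s] groups; a cell has at most [s]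
   rows; a group has at most [k <= s] columns; a group has [2 * s] scratch rows. *)
have rE i : (rdeg E i <= s)%N.
  apply: (@leq_card_inj _ _ (fun z => w z %/ (2 * s))%N) => [z z'|z].
    rewrite !inE => /EP[_ zZ _ e] /EP[_ z'Z _ e'] eq; apply: wI => //.
    by rewrite (divn_eq (w z) (2 * s)) (divn_eq (w z') (2 * s)) -e -e' eq.
  by rewrite inE => /EP[].
have cE z : (cdeg E z <= s)%N.
  apply: leq_trans (card_cell (v (w z %/ (2 * s))%N) cX cV (w z %% (2 * s))%N).
  by apply: subset_leq_card; apply/subsetP=> i; rewrite !inE => /EP[-> _ _ /eqP].
have rL z : (rdeg L z <= s)%N.
  apply: leq_trans ks; apply: (@leq_card_divn _ _ u _ (w z %/ (2 * s))%N) => // [y y'|y].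
    by rewrite !inE => /LP[_ yY _] /LP[_ y'Y _]; apply: uI.
  by rewrite inE => /LP[].
have cL y : (cdeg L y <= 2 * s)%N.
  apply: (@leq_card_divn _ _ w _ (u y %/ k)%N) => // [z z'|z].
    by rewrite !inE => /LP[zZ _ _] /LP[z'Z _ _]; apply: wI.
  by rewrite inE => /LP[].
have EX i z : E i z != 0 -> i \in X /\ z \notin X.
  by case/EP=> iX zZ _ _; rewrite (disjointFr dZX zZ).
have LZ z y : L z y != 0 -> z \in Z /\ y \notin Z.
  by case/LP=> zZ yY _; rewrite (disjointFr dYZ yY).
have EE : E *m E = 0.
  by apply: (mulmx_support0 dZX) => i z /EP[].
have LL : L *m L = 0.
  by apply: (mulmx_support0 dYZ) => i z /LP[].
have LE : L *m E = 0.
  by rewrite disjoint_sym in dXY; apply: (mulmx_support0 dXY) => i z; [case/LP|case/EP].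
have Ed i z : E i z != 0 -> (rdeg E i + cdeg E z <= (2 * s).+1)%N.
  by have := rE i; have := cE z; lia.
have Ld z y : L z y != 0 -> (rdeg L z + cdeg L y <= (3 * s).+1)%N.
  by have := rL z; have := cL y; lia.
rewrite NE (commutator_mx EE LL LE).
have -> : (10 * s = (2 * s + 3 * s) + (2 * s + 3 * s))%N by lia.
by do !apply: depthM; do ?[exact: edepth_sparse EX Ed|exact: edepth_sparse LZ Ld|
  exact: edepth_sparse_opp EX Ed|exact: edepth_sparse_opp LZ Ld].
Qed.

End Block.

(** * Matrices supported on a rectangle of disjoint index sets *)

Section OffDiagonal.
Variable F : finFieldType.

Lemma depth_unipotentD (d e n : nat) (N1 N2 : 'M[F]_n) : N1 *m N2 = 0 ->
  depth (@elim F) d (1%:M + N1) -> depth (@elim F) e (1%:M + N2) ->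
  depth (@elim F) (d + e) (1%:M + (N1 + N2)).
Proof.
move=> N0 d1 d2; have := depthM d1 d2.
by rewrite mulmxDl mul1mx mulmxDr mulmx1 N0 addr0 -addrA [N2 + N1]addrC.
Qed.

Lemma matrix_support0 n (N : 'M[F]_n) : (forall i j, ~~ (N i j != 0)) -> N = 0.
Proof. by move=> N0; apply/matrixP=> i j; rewrite mxE; apply/eqP/negPn. Qed.

Lemma edepth_columns n s k b (X Y : {set 'I_n}) (N : 'M[F]_n) :
  [disjoint X & Y] -> (0 < k)%N -> (4 * s ^ 2 <= n)%N -> (#|F| ^ k <= s)%N ->
  (#|X| <= s ^ 2)%N -> (#|Y| <= b * (s * k))%N ->
  (forall i j, N i j != 0 -> i \in X /\ j \in Y) ->
  depth (@elim F) (b * (10 * s)) (1%:M + N).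
Proof.
move=> + k0 ns qk cX; elim: b Y N => [|b IH] Y N dXY cY NXY.
  rewrite (@matrix_support0 _ N) /= ?addr0 // => i j; apply/negP=> /NXY[_].
  by move: cY; rewrite leqn0 cards_eq0 => /eqP->; rewrite inE.
have [Y1 [sY1 cY1 cY2]] := set_split cY.
pose N1 := \matrix_(i, j) (if j \in Y1 then N i j else 0).
pose N2 := \matrix_(i, j) (if j \in Y1 then 0 else N i j).
have N1P i j : N1 i j != 0 -> i \in X /\ j \in Y1.
  by rewrite mxE; case: ifP => [jY /NXY[]|]; rewrite ?eqxx.
have N2P i j : N2 i j != 0 -> i \in X /\ j \in Y :\: Y1.
  by rewrite mxE inE; case: ifP => [|jY /NXY[]]; rewrite ?eqxx.
have -> : N = N1 + N2.
  by apply/matrixP=> i j; rewrite !mxE; case: ifP; rewrite ?addr0 ?add0r.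
have dXY1 : [disjoint X & Y1] by apply: disjointWr dXY.
have dXY2 : [disjoint X & Y :\: Y1] by apply: disjointWr dXY; apply: subsetDl.
rewrite mulSn; apply: depth_unipotentD; last exact: IH dXY2 cY2 N2P.
  by rewrite disjoint_sym in dXY1; apply: (mulmx_support0 dXY1) => i j; [case/N1P|case/N2P].
have ks : (k <= s)%N.
  by apply: leq_trans qk; apply: ltnW; apply: ltn_expl; exact: finNzRing_gt1.
(* Every index outside [X] and [Y1] serves as scratch, the rest of [Y] included. Both sets have at
   most [s^2] elements, which leaves at least [2 * s^2] of the [4 * s^2]. *)
apply: (@edepth_batch _ _ s k X Y1 (~: (X :|: Y1))) N1P => //.
- by rewrite disjoint_sym -subsets_disjoint subsetUl.
- by rewrite -subsets_disjoint subsetUr.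
- rewrite -(leq_add2l #|X :|: Y1|) cardsC card_ord; apply: leq_trans ns.
  rewrite (_ : 4 * s ^ 2 = 2 * s ^ 2 + 2 * s ^ 2)%N ?leq_add2r; last lia.
  apply: leq_trans (leq_card_setU X Y1) _.
  by rewrite mul2n -addnn leq_add // (leq_trans cY1) // -mulnn leq_mul2l ks orbT.
Qed.

Lemma edepth_offdiag n s k r b (X Y : {set 'I_n}) (N : 'M[F]_n) :
  [disjoint X & Y] -> (0 < k)%N -> (4 * s ^ 2 <= n)%N -> (#|F| ^ k <= s)%N ->
  (#|X| <= r * s ^ 2)%N -> (#|Y| <= b * (s * k))%N ->
  (forall i j, N i j != 0 -> i \in X /\ j \in Y) ->
  depth (@elim F) (r * (b * (10 * s))) (1%:M + N).
Proof.
move=> + k0 ns qk + cY; elim: r X N => [|r IH] X N dXY cX NXY.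
  rewrite (@matrix_support0 _ N) /= ?addr0 // => i j; apply/negP=> /NXY[+ _].
  by move: cX; rewrite leqn0 cards_eq0 => /eqP->; rewrite inE.
have [X1 [sX1 cX1 cX2]] := set_split cX.
pose N1 := \matrix_(i, j) (if i \in X1 then N i j else 0).
pose N2 := \matrix_(i, j) (if i \in X1 then 0 else N i j).
have N1P i j : N1 i j != 0 -> i \in X1 /\ j \in Y.
  by rewrite mxE; case: ifP => [jY /NXY[]|]; rewrite ?eqxx.
have N2P i j : N2 i j != 0 -> i \in X :\: X1 /\ j \in Y.
  by rewrite mxE inE; case: ifP => [|jY /NXY[]]; rewrite ?eqxx.
have -> : N = N1 + N2.
  by apply/matrixP=> i j; rewrite !mxE; case: ifP; rewrite ?addr0 ?add0r.
have dXY1 : [disjoint X1 & Y] by apply: disjointWl dXY.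
have dXY2 : [disjoint X :\: X1 & Y] by apply: disjointWl dXY; apply: subsetDl.
rewrite mulSn; apply: depth_unipotentD; last exact: IH dXY2 cX2 N2P.
  by rewrite disjoint_sym in dXY2; apply: (mulmx_support0 dXY2) => i j; [case/N1P|case/N2P].
exact: edepth_columns dXY1 k0 ns qk cX1 cY N1P.
Qed.

End OffDiagonal.

(** * Unitriangular matrices *)

Section Unitriangular.
Variable F : fieldType.

Definition unitriangular n (U : 'M[F]_n) : Prop :=
  forall i j : 'I_n, (j <= i)%N -> U i j = (i == j)%:R.

Lemma unitriangular_unit n (U : 'M[F]_n) : unitriangular U -> U \in unitmx.
Proof.
move=> Uut; rewrite unitmxE -det_tr det_trig.
  by rewrite big1 ?unitr1 // => i _; rewrite mxE Uut ?eqxx.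
by apply/is_trig_mxP=> i j ij; rewrite mxE Uut ?(ltnW ij) //; case: eqP ij => // ->; rewrite ltnn.
Qed.

End Unitriangular.

Section Recursion.
Variable F : finFieldType.

(** Let [A], [B], [D] be the upper left, upper right and lower right blocks of [U], with [A] of size
    [m]. Then [U] is [1 + N] times the block sum of [A] and [D], where [N] has the single block
    [B *m D^-1]. Each peeling costs [e]; as [A] and [D] run in parallel, [d] is paid only once. *)
Lemma unitriangular_split (m d e J : nat) :
  (forall n (U : 'M[F]_n), (n <= m)%N -> unitriangular U -> depth (@elim F) d U) ->
  (forall n (S : {set 'I_n}) (N : 'M[F]_n), (m < n <= J * m)%N ->
     (forall i j, N i j != 0 -> i \in S /\ j \in ~: S) -> depth (@elim F) e (1%:M + N)) ->
  forall n (U : 'M[F]_n), (n <= J * m)%N -> unitriangular U ->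
  depth (@elim F) (J * e + d) U.
Proof.
move=> Hd He n U nJ; have : exists2 j, (n <= j * m)%N & (j <= J)%N by exists J.
case=> j nj jJ Uut; apply: (@edepth_le _ (j * e + d)); first by rewrite leq_add2r leq_mul2r jJ orbT.
elim: j n U nj jJ nJ Uut => [|j IH] n U nj jJ nJ Uut.
  by apply: Hd => //; apply: leq_trans nj _.
have [le|lt] := leqP n m.
  by apply: edepth_le (Hd _ _ le Uut); rewrite leq_addl.
move: U Uut nj nJ (He n); rewrite lt -(subnKC (ltnW lt)); move: (n - m)%N => n' {lt}.
move=> U Uut nj nJ /= He'.
have Uul : unitriangular (ulsubmx U).
  by move=> i i' le; rewrite !mxE Uut ?(inj_eq (@lshift_inj _ _)).
have Udr : unitriangular (drsubmx U).
  by move=> i i' le; rewrite !mxE Uut ?(inj_eq (@rshift_inj _ _)) //= leq_add2l.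
have Udl : dlsubmx U = 0.
  apply/matrixP=> i i'; rewrite !mxE Uut /= ?eq_rlshift //.
  by apply: leq_trans (ltnW (ltn_ord i')) (leq_addr _ _).
have -> : U = (1%:M + block_mx 0 (ursubmx U *m invmx (drsubmx U)) 0 0) *m
    block_mx (ulsubmx U) 0 0 (drsubmx U).
  rewrite -[LHS]submxK Udl scalar_mx_block add_block_mx !addr0 add0r mulmx_block.
  by rewrite !mul1mx !mul0mx !mulmx0 !addr0 !add0r mulmxKV ?unitriangular_unit.
rewrite mulSn -addnA; apply: depthM.
  refine (He' [set i : 'I_(m + n') | (i < m)%N] _ nJ _).
  move=> i i'; case: (split_ordP i) => i1 ->; case: (split_ordP i') => i2 ->;
  rewrite ?block_mxEul ?block_mxEur ?block_mxEdl ?block_mxEdr ?[(0 : 'M__) _ _]mxE ?eqxx //.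
  by move=> _; rewrite !inE /= ltn_ord -leqNgt leq_addr.
apply: edepth_block; first by apply: edepth_le (Hd _ _ (leqnn m) Uul); rewrite leq_addl.
apply: IH => //; first by move: nj; rewrite mulSn leq_add2l.
  exact: ltnW.
exact: leq_trans (leq_addl _ _) nJ.
Qed.

Local Notation q := #|F|.

(** One recursion level, with [a = q^2], [s = q^K], [t = s %/ K]. Both [a * e * K] and [d * K] are
    at most [B = 320 * a^3 * s^2], and [K.+1 <= 2 * K]; the resulting [4 * B] is at most [a * B]
    because [4 <= a]. *)
Lemma level_arith (a s K t d : nat) : (4 <= a)%N -> (0 < K <= s)%N -> (t * K <= s)%N ->
  (d * K <= 320 * a ^ 3 * s ^ 2)%N ->
  ((a * (4 * a * (4 * a * (t + 1) * (10 * s))) + d) * K.+1 <= 320 * a ^ 3 * (a * s ^ 2))%N.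
Proof.
move=> a4 /andP[K0 Ks] tK dK; set e := (4 * a * _)%N.
have eK : (e * K <= 320 * a ^ 2 * s ^ 2)%N.
  rewrite (_ : e * K = 160 * a ^ 2 * (s * (t * K + K)))%N; last by rewrite /e; ring.
  rewrite (_ : 320 * a ^ 2 * s ^ 2 = 160 * a ^ 2 * (s * (s + s)))%N; last by ring.
  by rewrite leq_mul // leq_mul // leq_add.
have aeK : (a * e * K <= 320 * a ^ 3 * s ^ 2)%N.
  rewrite -mulnA (_ : 320 * a ^ 3 * s ^ 2 = a * (320 * a ^ 2 * s ^ 2))%N; last by ring.
  by rewrite leq_mul.
apply: (@leq_trans ((a * e + d) * (2 * K))%N); first by rewrite leq_mul //; lia.
rewrite (_ : _ * (2 * K) = 2 * (a * e * K + d * K))%N; last by ring.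
apply: (@leq_trans (4 * (320 * a ^ 3 * s ^ 2))%N); first by lia.
by rewrite (_ : 320 * a ^ 3 * (a * s ^ 2) = a * (320 * a ^ 3 * s ^ 2))%N ?leq_mul //; ring.
Qed.

(** The factor 4 in the size makes every matrix too large for one level have the [4 * s^2] indices
    that the scratch rows of the next level require. *)
Lemma edepth_unitriangular (k : nat) : exists2 d : nat,
  (d * k.+1 <= 320 * q ^ 6 * q ^ (2 * k.+1))%N &
  forall n (U : 'M[F]_n), (n <= 4 * q ^ (2 * k.+1))%N -> unitriangular U ->
  depth (@elim F) d U.
Proof.
have q1 : (1 < q)%N := finNzRing_gt1 F.
elim: k => [|k [d dk IH]].
  (* Blocks of size 1 are trivial; each of at most [4 * q^2] peelings has degree sums at most
     [8 * q^2]. *)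
  exists (4 * q ^ 2 * (8 * q ^ 2) + 0)%N.
    rewrite muln1 addn0 muln1 (_ : 4 * q ^ 2 * (8 * q ^ 2) = 32 * q ^ 4)%N; last by ring.
    by rewrite -mulnA leq_mul // -expnD leq_pexp2l // ltnW.
  move=> n U nq; apply: (unitriangular_split (m := 1)); last by move: nq; rewrite !muln1.
    move=> [|[|m]] V // _ Vut; apply/matrixP=> i j; first by case: i.
    by rewrite mxE Vut // !ord1.
  move=> m S N; rewrite muln1 => /andP[_ mq] NS.
  apply: (@edepth_sparse _ _ _ _ S) => i j nz; first by have := NS _ _ nz; rewrite inE.
  have := max_card [set j | N i j != 0]; have := max_card [set i | N i j != 0].
  rewrite -/(rdeg _ _) -/(cdeg _ _) card_ord; move: mq; lia.
set K := k.+1; set s := (q ^ K)%N.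
have sE : (q ^ (2 * K) = s ^ 2)%N by rewrite mulnC expnM.
(* At most [4 * q^2 * s^2] rows and columns: rows in chunks of [s^2], columns in chunks of [s * K],
   the [+ 1] rounding [s / K] up. *)
pose e := ((4 * q ^ 2) * ((4 * q ^ 2 * (s %/ K + 1)) * (10 * s)))%N.
have Ks : (K <= s)%N by apply/ltnW/ltn_expl.
exists (q ^ 2 * e + d)%N.
  rewrite (_ : q ^ 6 = (q ^ 2) ^ 3)%N; last by rewrite -expnM.
  rewrite (mulnS 2) expnD sE; apply: level_arith => //.
  - by rewrite (@leq_exp2r 2 q 2).
  - exact: leq_trunc_div.
  - by rewrite -sE -expnM.
move=> n U nq; apply: (unitriangular_split (m := 4 * q ^ (2 * K))%N) => //.
  move=> m S N /andP[mlo mhi] NS.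
  have cS (A : {set 'I_m}) : (#|A| <= 4 * q ^ 2 * s ^ 2)%N.
    rewrite -sE; apply: leq_trans (max_card _) _; rewrite card_ord; apply: leq_trans mhi _.
    by rewrite mulnCA mulnA.
  apply: (@edepth_offdiag _ _ s K _ _ S (~: S)) => //.
  - by rewrite -subsets_disjoint.
  - by rewrite -sE ltnW.
  - apply: leq_trans (cS _) _.
    rewrite (_ : 4 * q ^ 2 * (s %/ K + 1) * (s * K) = 4 * q ^ 2 * (s * ((s %/ K + 1) * K)))%N;
      last by ring.
    by rewrite leq_mul // -mulnn leq_mul // addn1 ltnW // ltn_ceil.
by move: nq; rewrite (mulnS 2) expnD mulnCA.
Qed.

End Recursion.

(** * Permutations and general matrices *)

Section PermInvolutions.
Local Open Scope group_scope.
Variables (T : finType) (s : {perm T}).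

(* On each cycle of [s], with base point [r], the reflection [s^k r -> s^-k r]. *)
Let refl (x : T) : T := let r := froot s x in (s^-1 ^+ findex s r x) r.

(** The exponent chosen by [findex] is immaterial: if two powers of [s] agree at [r], so do their
    inverses. *)
Let refl_expg r k : froot s r = r -> refl ((s ^+ k) r) = (s^-1 ^+ k) r.
Proof.
move=> rr; have rx : froot s ((s ^+ k) r) = r.
  rewrite -[RHS]rr; apply/eqP; rewrite root_connect; last exact/fconnect_sym/perm_inj.
  by rewrite (fconnect_sym (@perm_inj _ s)) permX fconnect_iter.
rewrite /refl rx; set k' := findex _ _ _.
have e : (s ^+ k') r = (s ^+ k) r.
  by rewrite permX iter_findex // permX fconnect_iter.
apply: (@perm_inj _ (s ^+ (k + k'))); rewrite -!permM expgD !expgVn.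
by rewrite mulKg -expgD addnC expgD mulKg.
Qed.

Let refl_expVg r k : froot s r = r -> refl ((s^-1 ^+ k) r) = (s ^+ k) r.
Proof.
move=> rr; have -> : s^-1 ^+ k = s ^+ (#[s].-1 * k) by rewrite expgM -invg_expg.
by rewrite refl_expg // expgM -orderV -invg_expg invgK.
Qed.

Let cycleP x : exists2 r, froot s r = r & exists k, x = (s ^+ k) r.
Proof.
exists (froot s x); first exact/root_root/fconnect_sym/perm_inj.
exists (findex s (froot s x) x); rewrite permX iter_findex //.
by rewrite (fconnect_sym (@perm_inj _ s)) connect_root.
Qed.

Lemma perm_mul_involutions :
  exists t u : {perm T}, [/\ involutive t, involutive u & s = t * u].
Proof.
have reflK : involutive refl.
  by move=> x; have [r rr [k ->]] := cycleP x; rewrite refl_expg // refl_expVg.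
have reflsK : involutive (refl \o s).
  move=> x /=; have [r rr [k ->]] := cycleP x; rewrite -permM -expgSr refl_expg //.
  by rewrite expgSr permM permKV refl_expVg.
(* [refl \o s] sends [s^k r] to [s^-(k+1) r], again a reflection of each cycle; composing with
   [refl] gives back [s]. *)
exists (perm (inv_inj reflsK)), (perm (inv_inj reflK)); split.
- by move=> x; rewrite !permE reflsK.
- by move=> x; rewrite !permE reflK.
- by apply/permP=> x; rewrite permM !permE /= reflK.
Qed.

End PermInvolutions.

Section Gauss.
Variable F : fieldType.

(** On each swapped pair, three shears with coefficients 1, -1, 1 give the swap up to a sign, which
    the diagonal factor corrects; all pairs are treated at once. *)
Lemma pdepth_involution n (t : 'S_n) : involutive t ->
  depth (@pgem F) 4 (perm_mx t).
Proof.
move=> tK.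
pose G (f : 'I_n -> bool) (c : F) := \matrix_(i, j) (if f i && (j == t i) then c else 0).
have GP f c i j : G f c i j != 0 -> f i /\ j = t i.
  by rewrite mxE; case: ifP => [/andP[-> /eqP->]|]; rewrite ?eqxx.
have rowG f c (X : 'M_n) i j :
    ((1%:M + G f c) *m X) i j = X i j + (if f i then c * X (t i) j else 0).
  rewrite mulmxDl mul1mx mxE; congr (_ + _); rewrite mxE (bigD1 (t i)) //= big1.
    by rewrite addr0 mxE eqxx andbT; case: (f i); rewrite ?mul0r.
  by move=> k /negPf kt; rewrite mxE kt andbF mul0r.
have eG (f : 'I_n -> bool) c : (forall i, f i -> ~~ f (t i)) -> pgem (1%:M + G f c).
  move=> ft; apply/elim_pgem/matching_elim; split.
  - by move=> i j j' /GP[_ ->] /GP[].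
  - by move=> i i' j /GP[_ ->] /GP[_ /perm_inj].
  - move=> i j k /GP[fi _]; apply/eqP/negPn/negP=> /GP[fk ik].
    by move: (ft _ fk); rewrite -ik fi.
pose d := \row_i (if (t i < i)%N then -1 else 1 : F).
pose up (i : 'I_n) := (i < t i)%N; pose down (i : 'I_n) := (t i < i)%N.
exists (diag_mx d), ((1%:M + G up 1) *m ((1%:M + G down (-1)) *m (1%:M + G up 1))).
split.
- right; right; exists d; split=> // k; rewrite mxE; case: ifP; rewrite ?oppr_eq0 oner_eq0 //.
- exists (1%:M + G up 1), ((1%:M + G down (-1)) *m (1%:M + G up 1)); split=> //.
    by apply: eG => i; rewrite /up tK -leqNgt => /ltnW.
  exists (1%:M + G down (-1)), (1%:M + G up 1); split=> //.
    by apply: eG => i; rewrite /down tK -leqNgt => /ltnW.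
  by apply: depth1; apply: eG => i; rewrite /up tK -leqNgt => /ltnW.
- rewrite -[1%:M + G up 1 in X in _ *m (_ *m (_ *m X))]mulmx1.
  apply/matrixP=> i j; rewrite mul_diag_mx [RHS]mxE !rowG tK /up /down !mxE tK -!val_eqE /=.
  by case: (ltngtP i (t i)) => [lt|lt|/ord_inj e]; rewrite -?e; ring.
Qed.

Lemma pdepth_perm n (s : 'S_n) : depth (@pgem F) 8 (perm_mx s).
Proof.
have [t [u [tK uK ->]]] := perm_mul_involutions s.
by rewrite perm_mxM; apply: (@depthM _ _ 4 4); apply: pdepth_involution.
Qed.

Lemma upper_diag_unitriangular n (U : 'M[F]_n) : U \in unitmx ->
  (forall i j : 'I_n, (j < i)%N -> U i j = 0) ->
  exists (d : 'rV_n) (U' : 'M_n),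
    [/\ forall k, d 0 k != 0, U = diag_mx d *m U' & unitriangular U'].
Proof.
move=> Uu U0; exists (\row_i U i i), (\matrix_(i, j) (U i j / U i i)).
have nz i : U i i != 0.
  move: Uu; rewrite unitmxE -det_tr det_trig; last first.
    by apply/is_trig_mxP=> k l kl; rewrite mxE U0.
  by rewrite unitfE => /prodf_neq0 /(_ i isT); rewrite mxE.
split=> [k| |i j ji]; first by rewrite mxE.
  by apply/matrixP=> i j; rewrite mul_diag_mx !mxE mulrC divfK.
rewrite mxE; case: eqP => [->|ij]; first by rewrite divff.
by rewrite U0 ?mul0r // ltn_neqAle ji andbT eq_sym; apply/eqP=> /ord_inj.
Qed.

(** LUP decomposition: 8 for the permutation, [d] for [L] (its transpose is upper unitriangular), 1
    for the diagonal, [d] for the rest of the upper factor. *)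
Lemma pdepth_unitmx n d (A : 'M[F]_n.+1) : A \in unitmx ->
  (forall U : 'M[F]_n.+1, unitriangular U -> depth (@elim F) d U) ->
  depth (@pgem F) (8 + (d + (1 + d))) A.
Proof.
move=> Au Hd; have := cormen_lup_correct A; have := cormen_lup_perm A.
have := cormen_lup_lower A; have := cormen_lup_upper A.
case: (cormen_lup A) => [[P L] U] /= U0 Ll /is_perm_mxP[s ->] PA.
have Uu : U \in unitmx.
  have : perm_mx s *m A \in unitmx by rewrite unitmx_mul unitmx_perm.
  by rewrite [_ *m _]PA unitmx_mul => /andP[].
have [D [U' [D0 UE U'u]]] := upper_diag_unitriangular Uu U0; rewrite UE in PA.
have -> : A = perm_mx s^-1 *m (L *m (diag_mx D *m U')).
  by rewrite perm_mxV -[in RHS]/(L * _)%R -PA mulKmx ?unitmx_perm.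
apply: (@depthM _ _ 8); first exact: pdepth_perm.
apply: (@depthM _ _ d (1 + d)).
  apply: (@depth_sub _ (@elim F)); first exact: elim_pgem.
  rewrite -[L]trmxK; apply: edepth_tr; refine (Hd L^T _) => i j ji.
  by rewrite mxE Ll // eq_sym.
apply: (@depthM _ _ 1); first by apply: depth1; right; right; exists D.
by apply: (@depth_sub _ (@elim F)); [exact: elim_pgem|exact: Hd].
Qed.

Lemma pdepth_seq n d (A : 'M[F]_n) : depth (@pgem F) d A ->
  exists Rs : seq 'M[F]_n, [/\ forall R, R \in Rs -> pgem R, size Rs = d &
    forall M, apply_seq Rs M = A *m M].
Proof.
elim: d A => [|d IH] A /=; first by move=> ->; exists [::]; split=> // M; rewrite mul1mx.
case=> E [B [gE /IH[Rs [gRs sz RsM]] ->]]; exists (rcons Rs E); split.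
- by move=> R; rewrite mem_rcons inE => /predU1P[->|/gRs].
- by rewrite size_rcons sz.
- by move=> M; rewrite /apply_seq -cats1 foldl_cat /= -/(apply_seq Rs M) RsM mulmxA.
Qed.

End Gauss.

(** Here [K] replaces the logarithm: it exceeds the integer logarithm of [n] to base [q^2] by 1, so
    [q^(2K)] lies between [n] and [q^2 * n]. The sequence comes from factoring [invmx M]. *)
Lemma exists_elimination (F : finFieldType) (n : nat) (M : 'M[F]_n) : (2 <= n)%N ->
  M \in unitmx -> exists K (Rs : seq 'M[F]_n),
  [/\ forall R, R \in Rs -> pgem R, apply_seq Rs M = 1%:M,
      (n <= #|F| ^ (2 * K))%N &
      (size Rs * K <= (9 + 640 * #|F| ^ 6) * #|F| ^ 2 * n)%N].
Proof.
set q := #|F|; have q1 : (1 < q)%N := finNzRing_gt1 F.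
case: n M => // n M n2 Mu.
have q2 : (1 < q ^ 2)%N by rewrite (ltn_exp2l 0).
have /andP[kn nk] := trunc_log_bounds q2 (ltnW n2).
set k := trunc_log _ _ in kn nk; rewrite -!expnM in kn nk.
have [d dk Hd] := edepth_unitriangular F k.
have dA : depth (@pgem F) (8 + (d + (1 + d))) (invmx M).
  apply: pdepth_unitmx; first by rewrite unitmx_inv.
  by move=> U Uut; apply: Hd => //; apply: leq_trans (ltnW nk) (leq_pmull _ _).
have [Rs [gRs sz RsM]] := pdepth_seq dA.
exists k.+1, Rs; split=> //; [by rewrite RsM mulVmx | exact: ltnW |].
have kq : (k.+1 <= q ^ (2 * k.+1))%N.
  by apply: leq_trans (ltnW (ltn_expl _ q1)) _; rewrite leq_exp2l // leq_pmull.
apply: (@leq_trans ((9 + 640 * q ^ 6) * q ^ (2 * k.+1))); last first.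
  by rewrite (mulnS 2) expnD mulnA leq_mul.
rewrite sz (_ : _ * k.+1 = 9 * k.+1 + 2 * (d * k.+1))%N; last by ring.
rewrite mulnDl leq_add //; first by rewrite leq_mul.
by apply: leq_trans (leq_mul (leqnn 2) dk) _; rewrite !mulnA.
Qed.

(* Imported only here: it rebinds [%N] and the notation [^] on [nat]. *)
From Stdlib Require Import Reals Lra.
Local Close Scope ring_scope.


(** * From the integer bound to natural logarithms *)

Lemma INR_expn (m n : nat) : INR (expn m n) = (INR m ^ n)%R.
Proof. by elim: n => //= n IH; rewrite expnS mult_INR IH. Qed.

Lemma le_ln_expn (q e n : nat) : (1 < q)%N -> (0 < n)%N -> (n <= expn q e)%N ->
  (ln (INR n) <= INR e * ln (INR q))%R.
Proof.
move=> q1 n0 /leP/le_INR nq; have q0 : (0 < INR q)%R by apply/lt_0_INR/ltP/ltnW.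
rewrite -(ln_pow _ q0) -INR_expn; case: nq => [lt|->]; last exact: Rle_refl.
by apply/Rlt_le/ln_increasing => //; apply/lt_0_INR/ltP.
Qed.

Theorem theorem3 (F : finFieldType) :
  exists C : R, (0 < C)%R /\
    forall (n : nat), (2 <= n)%N ->
    forall M : 'M[F]_n, M \in unitmx ->
    exists Rs : seq 'M[F]_n,
      (forall R, R \in Rs -> pgem R) /\
      (INR (size Rs) <= C * INR n / ln (INR n))%R /\
      apply_seq Rs M = scalar_mx (GRing.one F).
Proof.
have q1 : (1 < #|F|)%N := finNzRing_gt1 F.
have lnq : (0 < ln (INR #|F|))%R.
  by rewrite -ln_1; apply: ln_increasing; [exact: Rlt_0_1|apply/(lt_INR 1)/ltP].
set a := ((9 + 640 * expn #|F| 6) * expn #|F| 2)%N.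
have a0 : (0 < INR a)%R.
  by apply/lt_0_INR/ltP; rewrite muln_gt0 expn_gt0 (ltnW q1) addn_gt0.
(* Multiply [size Rs * K <= a * n] by [2 * ln q] and use [ln n <= 2 * K * ln q]. *)
exists (INR a * (2 * ln (INR #|F|)))%R; split; first by apply: Rmult_lt_0_compat; lra.
move=> n n2 M Mu; have [K [Rs [gRs RsM nK sK]]] := exists_elimination n2 Mu.
exists Rs; split=> //; split=> //.
have lnn : (0 < ln (INR n))%R.
  by rewrite -ln_1; apply: ln_increasing; [exact: Rlt_0_1|apply/(lt_INR 1)/ltP].
apply: (Rmult_le_reg_r _ _ _ lnn); rewrite /Rdiv Rmult_assoc Rinv_l; last lra.
have {}sK : (INR (size Rs) * INR K <= INR a * INR n)%R.
  by rewrite -!mult_INR; apply/le_INR/leP.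
have := le_ln_expn q1 (ltnW n2) nK; rewrite mult_INR => lnK.
apply: (Rle_trans _ (INR (size Rs) * (INR 2 * INR K * ln (INR #|F|)))).
  exact: Rmult_le_compat_l (pos_INR _) lnK.
have := Rmult_le_compat_r _ _ _ (Rlt_le _ _ lnq) sK; rewrite /=; nra.
Qed.
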